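(* Assume $k = 1$, values are i.i.d. (all $F_i = F$ on $[0,\bar v]$), and $A$ is the efficient allocation rule (any tie-breaking). Among all (non-negative) payment rules $P$ that implement $A$ — without requiring ex-post individual rationality — the winner-pays-bid rule minimizes $\mathbb E[g(R)]$ for every convex $g : \mathbb R \to \mathbb R$ (for which the expectations exist), where $R = \sum_i P_i(\bm v)$; i.e. $\mathbb E[g(\sum_i P_i^{\mathrm{WPB}}(\bm v))] \le \mathbb E[g(\sum_i P_i(\bm v))]$.
   Context: Setting: $n$ risk-neutral unit-demand bidders and $k$ identical items, $1 \le k < n$. Bidder $i$ has private value $v_i \in \mathcal V_i = [0,\bar v_i]$, drawn independently across bidders from a distribution $F_i$ with density $f_i > 0$ on $\mathcal V_i$; $\bm v = (v_1,\dots,v_n)$, $\mathcal V = \prod_i \mathcal V_i$. An allocation rule is a measurable map $A : \mathcal V \to \{0,1\}^n$ with $\sum_i A_i(\bm v) \le k$. Its interim allocation is $x_i(v_i) = \mathbb E[A_i(\bm v) \mid v_i]$; its interim payment function is $z_i(v_i) = v_i x_i(v_i) - \int_0^{v_i} x_i(u)\,du$. The efficient allocation rule (single item) gives the item to a bidder with the highest value, ties broken by any fixed rule. A payment rule is a measurable map $P : \mathcal V \to [0,\infty)^n$ (payments are non-negative). $P$ implements $A$ if $(A,P)$ is Bayesian incentive compatible, i.e. $\mathbb E[v_i A_i(\bm v) - P_i(\bm v) \mid v_i] \ge \mathbb E[v_i A_i(v_i',\bm v_{-i}) - P_i(v_i',\bm v_{-i}) \mid v_i]$ for all $i, v_i,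 v_i'$, and satisfies revenue equivalence $\mathbb E[P_i(\bm v) \mid v_i] = z_i(v_i)$ for all $i, v_i$. The winner-pays-bid (WPB) payment rule is $P_i^{\mathrm{WPB}}(\bm v) = b_i^{\mathrm{WPB}}(v_i) A_i(\bm v)$ with $b_i^{\mathrm{WPB}}(v_i) = z_i(v_i)/x_i(v_i)$ when $x_i(v_i) > 0$ and $b_i^{\mathrm{WPB}}(v_i) = 0$ otherwise. *)

(* Defs.v *)
From HB Require Import structures.
From mathcomp Require Import all_boot all_order all_algebra.
From mathcomp Require Import all_classical all_reals all_analysis.
Set Implicit Arguments. Unset Strict Implicit. Unset Printing Implicit Defensive.
Import Order.TTheory GRing.Theory Num.Theory.
Import numFieldNormedType.Exports.
Local Open Scope classical_set_scope.
Local Open Scope ring_scope.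

Section auction.
Context {R : realType} {d : measure_display} {Omega : measurableType d}.
Context (P : probability Omega R) (n : nat).

(** value profile as an n-tuple (n.-tuple R carries the product Borel sigma-algebra) *)
Definition profile (V : 'I_n -> Omega -> R) (w : Omega) : n.-tuple R :=
  [tuple V i w | i < n].

Definition upd (v : n.-tuple R) (i : 'I_n) (x : R) : n.-tuple R :=
  [tuple if j == i then x else tnth v j | j < n].

Definition typespace (vbar : R) : set (n.-tuple R) :=
  [set v | forall j, tnth v j \in `[0, vbar]].

(** interim expectation E[h(v) | v_i = x]: bidder i's coordinate is fixed to x,
    the others v_{-i} are integrated out (they are independent of v_i). *)
Definition interim (V : 'I_n -> Omega -> R) (h : n.-tuple R -> R) (i : 'I_n) (x : R)
  : \bar R := (\int[P]_w (h (upd (profile V w) i x))%:E)%E.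

Definition interim_alloc V (A : n.-tuple R -> 'I_n -> bool) (i : 'I_n) (x : R) : R :=
  fine (interim V (fun v => (A v i)%:R) i x).

Definition interim_pay V A (i : 'I_n) (x : R) : \bar R :=
  ((x * interim_alloc V A i x)%:E
   - \int[lebesgue_measure]_(u in `[0%R, x]%classic) (interim_alloc V A i u)%:E)%E.

Definition bid_WPB V A (i : 'I_n) (x : R) : R :=
  if 0 < interim_alloc V A i x then fine (interim_pay V A i x) / interim_alloc V A i x
  else 0.

Definition pay_WPB V A (v : n.-tuple R) (i : 'I_n) : R :=
  bid_WPB V A i (tnth v i) * (A v i)%:R.

(** P implements A: Bayesian incentive compatibility + revenue equivalence *)
Definition implements (vbar : R) V (A : n.-tuple R -> 'I_n -> bool)
    (Pay : n.-tuple R -> 'I_n -> R) : Prop :=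
  (forall (i : 'I_n) (x x' : R), x \in `[0, vbar] -> x' \in `[0, vbar] ->
     (interim V (fun v => (x * (A v i)%:R - Pay v i)%R) i x'
       <= interim V (fun v => (x * (A v i)%:R - Pay v i)%R) i x)%E) /\
  (forall (i : 'I_n) (x : R), x \in `[0, vbar] -> interim V (fun v => Pay v i) i x = interim_pay V A i x).

End auction.

Definition mutually_independent {R : realType} {d : measure_display}
  {Omega : measurableType d} (P : probability Omega R) (n : nat)
  (V : 'I_n -> Omega -> R) : Prop :=
  forall B : 'I_n -> set R, (forall j, measurable (B j)) ->
    P (\bigcap_(j in [set: 'I_n]) (V j @^-1` B j)) = (\prod_(j < n) P (V j @^-1` B j))%E.

Definition expectation_exists {R : realType} {d : measure_display}
  {Omega : measurableType d} (P : probability Omega R) (X : Omega -> R) : Prop :=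
  (\int[P]_w (Num.max (X w) 0)%:E < +oo)%E \/ (\int[P]_w (Num.max (- X w) 0)%:E < +oo)%E.

Definition convex_fun {R : realType} (g : R -> R) : Prop :=
  forall x y t, 0 <= t <= 1 -> g (t * x + (1 - t) * y) <= t * g x + (1 - t) * g y.

(* Main.v *)
Require Import Defs.
From HB Require Import structures.
From mathcomp Require Import all_boot all_order all_algebra.
From mathcomp Require Import all_classical all_reals all_analysis.
From mathcomp Require Import measurable_realfun lra ring.
Import Order.TTheory GRing.Theory Num.Theory.
Import numFieldNormedType.Exports.
Local Open Scope classical_set_scope.
Local Open Scope ring_scope.

(** Let [s] be a nondecreasing subgradient of [g] and [b] the common WPB bid
    function, which is nondecreasing; the WPB revenue is [b m], [m] the highest
    value. For any revenue [R = sum_i P_i],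
      [g R >= g (b m) + s (b m) * (R - b m)],
    and since [P_i >= 0] and [v_i <= m], [s (b m) * P_i >= s (b v_i) * P_i]. Hence
      [g R >= g (b m) + sum_i s (b v_i) * (P_i - b v_i * A_i)],
    and each correction term has mean zero: conditionally on [v_i], revenue
    equivalence gives both [P_i] and [b v_i * A_i] the expectation [z_i v_i]. *)

(** * Monotonicity of the integral off a null set *)

Section integral_lower.
Import HBNNSimple.
Local Open Scope ereal_scope.
Context {d : measure_display} {T : measurableType d} {R : realType}.
Variable mu : {measure set T -> \bar R}.

(* [A] and [Pay] are measurable only on the type space. The integral of a nonnegative
   function, measurable or not, is the supremum over the simple functions below it. *)
Lemma ge0_le_integral_off_null (N : set T) (f g : T -> \bar R) :
  measurable N -> mu N = 0 ->
  (forall x, 0 <= f x) -> (forall x, 0 <= g x) ->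
  (forall x, ~ N x -> f x <= g x) ->
  \int[mu]_x f x <= \int[mu]_x g x.
Proof.
move=> mN N0 f0 g0 fg.
rewrite !ge0_integralTE//; apply: ge_ereal_sup => _ [h hf <-].
have mNC : measurable (~` N) by exact: measurableC.
(* Setting [h] to zero on [N] keeps its integral and puts it below [g] everywhere. *)
pose h' := proj_nnsfun h mNC.
have -> : sintegral mu h = sintegral mu h'.
  rewrite -!integralT_nnsfun; apply: ge0_ae_eq_integral => //.
  - by apply/measurable_EFinP.
  - by apply/measurable_EFinP.
  - by move=> x _; rewrite lee_fin.
  - by move=> x _; rewrite lee_fin.
  - exists N; split => // x /= xN; apply: contrapT => nNx; apply: xN => _.
    by rewrite mindicE mem_set// mulr1.
apply: ereal_sup_ubound => /=; exists h' => // x /=.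
rewrite mindicE; have [xN|xN] := boolP (x \in ~` N).
  by rewrite mulr1; apply: le_trans (hf x) (fg x _); rewrite inE in xN.
by rewrite mulr0.
Qed.

(** Positive parts keep the order of [f] and [g] and negative parts reverse it, so the nonnegative
    case applies to each. *)
Lemma le_integral_off_null (N : set T) (f g : T -> \bar R) :
  measurable N -> mu N = 0 -> (forall x, ~ N x -> f x <= g x) ->
  \int[mu]_x f x <= \int[mu]_x g x.
Proof.
move=> mN N0 fg; rewrite integralE [leRHS]integralE.
apply: leeB; apply: (@ge0_le_integral_off_null N) => // x nNx.
  by rewrite !funeposE; apply: le_max2 => //; exact: fg.
by rewrite !funenegE; apply: le_max2 => //; rewrite leeN2; exact: fg.
Qed.

Lemma eq_integral_off_null (N : set T) (f g : T -> \bar R) :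
  measurable N -> mu N = 0 -> (forall x, ~ N x -> f x = g x) ->
  \int[mu]_x f x = \int[mu]_x g x.
Proof.
move=> mN N0 fg; apply/eqP; rewrite eq_le.
by apply/andP; split; apply: (@le_integral_off_null N) => // x /fg ->.
Qed.

End integral_lower.

(** * Subgradients and measurability of convex functions on the line *)

Section convex.
Context {R : realType} (g : R -> R).
Hypothesis cg : convex_fun g.

Lemma convex_slope_le (a y c : R) : a < y -> y < c ->
  (g y - g a) / (y - a) <= (g c - g y) / (c - y).
Proof.
move=> ay yc.
have ya0 : 0 < y - a by rewrite subr_gt0.
have cy0 : 0 < c - y by rewrite subr_gt0.
have ca0 : 0 < c - a by lra.
(* This quotient is the weight [t] for which [y = t * a + (1 - t) * c]. *)
have t01 : 0 <= (c - y) / (c - a) <= 1.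
  by rewrite divr_ge0 ?ler_pdivrMr //=; lra.
have := cg a c _ t01.
have -> : (c - y) / (c - a) * a + (1 - (c - y) / (c - a)) * c = y.
  by field; rewrite gt_eqF.
have -> : (c - y) / (c - a) * g a + (1 - (c - y) / (c - a)) * g c
    = ((c - y) * g a + (y - a) * g c) / (c - a) by field; rewrite gt_eqF.
rewrite ler_pdivlMr// => h.
rewrite ler_pdivrMr// mulrAC ler_pdivlMr//; nra.
Qed.

(** The supremum of the slopes to the left of [y] works: every slope to the right is an upper bound
    of them. *)
Lemma convex_subgradient (y : R) : exists s, forall z, g y + s * (z - y) <= g z.
Proof.
pose S := [set (g y - g a) / (y - a) | a in [set a | a < y]].
have ub c : y < c -> ubound S ((g c - g y) / (c - y)).
  by move=> yc _ [a /= ay <-]; exact: convex_slope_le.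
have S0 : S !=set0 by exists ((g y - g (y - 1)) / (y - (y - 1))); exists (y - 1) => //=; lra.
have hS : has_sup S by split => //; exists ((g (y + 1) - g y) / (y + 1 - y)); apply: ub; lra.
exists (sup S) => z; have [zy|yz|->] := ltgtP z y; last by rewrite subrr mulr0 addr0.
- have : (g y - g z) / (y - z) <= sup S by apply: ub_le_sup; [exact: hS.2|exists z].
  by rewrite ler_pdivrMr ?subr_gt0//; lra.
- have : sup S <= (g z - g y) / (z - y) by apply: ge_sup => //; exact: ub.
  by rewrite ler_pdivlMr ?subr_gt0//; lra.
Qed.

(** Adding the subgradient inequalities at [y] and at [z] gives [(s z - s y) * (z - y) >= 0], so any
    choice of subgradients is monotone. *)
Lemma convex_monotone_subgradient : exists s : R -> R,
  (forall y z, g y + s y * (z - y) <= g z) /\ {homo s : y z / y <= z}.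
Proof.
have [s hs] := choice convex_subgradient; exists s; split => // y z.
rewrite le_eqVlt => /predU1P[->//|yz].
have := hs y z; have := hs z y => h1 h2.
rewrite -(ler_pM2r (_ : 0 < z - y)) ?subr_gt0//; lra.
Qed.

(** Sublevel sets of a convex function are intervals, and these preimages of rays suffice for
    measurability. *)
Lemma convex_measurable : measurable_fun setT g.
Proof.
apply: (measurability (@RGenInftyO.G R)) => [|/= _ [_] [r] -> <-].
  exact: RGenInftyO.measurableE.
rewrite setTI; apply: is_interval_measurable => x y /=.
rewrite !in_itv/= => gx gy z /andP[].
rewrite le_eqVlt => /predU1P[<-//|xz]; rewrite le_eqVlt => /predU1P[->//|zy].
rewrite /= in_itv/=; have := convex_slope_le _ _ _ xz zy.
rewrite ler_pdivrMr ?subr_gt0// mulrAC ler_pdivlMr ?subr_gt0// => h.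
have xz0 : 0 < z - x by rewrite subr_gt0.
have zy0 : 0 < y - z by rewrite subr_gt0.
nra.
Qed.

End convex.

(** * Laws of random tuples, determined by their values on boxes *)

Section tuple_law.
Context {R : realType} {n : nat}.

Definition box (B : 'I_n -> set R) : set (n.-tuple R) :=
  [set v | forall j, B j (tnth v j)].

Definition boxes : set (set (n.-tuple R)) :=
  [set box B | B in [set B | forall j, measurable (B j)]].

Lemma measurable_box (B : 'I_n -> set R) :
  (forall j, measurable (B j)) -> measurable (box B).
Proof.
move=> mB; have -> : box B = \bigcap_(j in [set: 'I_n]) ((fun v : n.-tuple R => tnth v j) @^-1` B j).
  by apply/seteqP; split => v /= h j; have := h j; [|exact].
apply: fin_bigcap_measurable => // j _.
by rewrite -[X in measurable X]setTI; exact: measurable_tnth.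
Qed.

(** A generator of the product sigma-algebra constrains one coordinate, hence is a box whose other
    sides are full; conversely a box is a finite intersection of such sets. *)
Lemma measurable_tuple_boxes : @measurable _ (n.-tuple R) = <<s boxes >>.
Proof.
apply/seteqP; split.
- apply: sub_sigma_algebra2; rewrite -bigcup_seq; apply: bigcup_sub => i _ _ [B mB <-].
  exists (fun j => if j == i then B else setT); first by move=> j; case: ifP.
  rewrite setTI; apply/seteqP; split => v /=; first by move=> /(_ i); rewrite eqxx.
  by move=> vB j; case: eqP => [->|].
- apply: smallest_sub; first exact: sigma_algebra_measurable.
  by move=> _ [B mB <-]; exact: measurable_box.
Qed.

Context {d d' : measure_display} {T : measurableType d} {T' : measurableType d'}.
Variables (mu : {measure set T -> \bar R}) (nu : {measure set T' -> \bar R}).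
Variables (X : T -> n.-tuple R) (Y : T' -> n.-tuple R).
Hypotheses (mX : measurable_fun setT X) (mY : measurable_fun setT Y).

(** Boxes are stable under intersection and generate the sigma-algebra, so the two image measures
    coincide, and with them all integrals of [h]. *)
Lemma ge0_integral_eq_boxes (h : n.-tuple R -> \bar R) :
  (mu setT < +oo)%E ->
  (forall B, (forall j, measurable (B j)) ->
     mu (X @^-1` box B) = nu (Y @^-1` box B)) ->
  measurable_fun setT h -> (forall v, 0 <= h v)%E ->
  (\int[mu]_w h (X w) = \int[nu]_w h (Y w))%E.
Proof.
move=> muT hB mh h0.
have pX := @ge0_integral_pushforward _ _ _ _ R _ mX mu setT h measurableT mh (fun y _ => h0 y).
have pY := @ge0_integral_pushforward _ _ _ _ R _ mY nu setT h measurableT mh (fun y _ => h0 y).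
rewrite preimage_setT in pX; rewrite preimage_setT in pY.
rewrite -[LHS]pX -[RHS]pY; apply: eq_measure_integral => A mA _.
apply: (measure_unique boxes (fun=> setT)) => //.
- exact: measurable_tuple_boxes.
- move=> _ _ [B mB <-] [C mC <-]; exists (fun j => B j `&` C j).
    by move=> j; exact: measurableI.
  apply/seteqP; split => v /=; first by move=> h1; split => j; have [] := h1 j.
  by move=> [h1 h2] j; split; [exact: h1|exact: h2].
- by move=> _; exists (fun=> setT) => //; apply/seteqP; split.
- by apply/seteqP; split => // x _; exists 0%N.
- by move=> _ [B mB <-]; exact: hB.
Qed.

End tuple_law.

(** * Replacing one coordinate of an independent profile by an independent copy *)

Section resampling.
Context {R : realType} {d : measure_display} {Omega : measurableType d}.
Context (P : probability Omega R) {n : nat} (V : 'I_n -> Omega -> R).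
Hypothesis mV : forall j, measurable_fun setT (V j).
Hypothesis indV : mutually_independent P V.

Lemma measurable_profile : measurable_fun setT (profile V).
Proof.
apply/measurable_fun_tnthP => j; apply: (eq_measurable_fun (V j)) => // w _.
by rewrite /= tnth_mktuple.
Qed.

Lemma measurable_resample (i : 'I_n) :
  measurable_fun setT (fun w : Omega * Omega => upd (profile V w.2) i (V i w.1)).
Proof.
apply/measurable_fun_tnthP => j.
apply: (eq_measurable_fun (if j == i then V i \o fst else V j \o snd)) => [w _|].
  by rewrite /= !tnth_mktuple; case: ifP.
by case: ifP => _; apply: measurableT_comp.
Qed.

Lemma measurable_upd_profile (i : 'I_n) (x : R) :
  measurable_fun setT (fun w : Omega => upd (profile V w) i x).
Proof.
apply/measurable_fun_tnthP => j.
apply: (eq_measurable_fun (if j == i then cst x else V j)) => [w _|].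
  by rewrite /= !tnth_mktuple; case: ifP.
by case: ifP.
Qed.

Lemma profile_boxE (B : 'I_n -> set R) : (forall j, measurable (B j)) ->
  P (profile V @^-1` box B) = (\prod_(j < n) P (V j @^-1` B j))%E.
Proof.
move=> mB; rewrite -indV//; congr (P _); apply/seteqP; split => w /= h j.
  by have := h j; rewrite tnth_mktuple.
by rewrite tnth_mktuple; exact: h.
Qed.

(** Under [P \x P], the profile at the second point with coordinate [i] read at the first point has
    the law of the original profile, since both give a box the product of its marginal
    probabilities. Tonelli then yields the iterated form, whose inner integral is an interim
    expectation. *)
Lemma ge0_integral_resample (i : 'I_n) (h : n.-tuple R -> \bar R) :
  measurable_fun setT h -> (forall v, 0 <= h v)%E ->
  (\int[P]_w h (profile V w) =
   \int[P]_w' \int[P]_w h (upd (profile V w) i (V i w')))%E.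
Proof.
move=> mh h0.
pose Y w := upd (profile V w.2) i (V i w.1).
have -> : (\int[P]_w' \int[P]_w h (upd (profile V w) i (V i w')) =
    \int[(P \x P)%E]_w h (Y w))%E.
  rewrite (@fubini_tonelli1 _ _ _ _ _ P P (h \o Y)) => [//||w]; last exact: h0.
  by apply: measurableT_comp => //; exact: measurable_resample.
apply: (@ge0_integral_eq_boxes _ _ _ _ _ _ P (P \x P)%E (profile V) Y) => //.
- exact: measurable_profile.
- exact: measurable_resample.
- by rewrite [X in (X < _)%E]probability_setT ltry.
move=> B mB.
(* Opening side [i] makes the preimage of the box a rectangle: side [i] constrains only the first
   point, [C] only the second. *)
pose C j := if j == i then setT else B j.
have mC j : measurable (C j) by rewrite /C; case: ifP.
have mpre j (D : set R) : measurable D -> measurable (V j @^-1` D).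
  by move=> mD; rewrite -[X in measurable X]setTI; exact: mV.
have -> : Y @^-1` box B = (V i @^-1` B i) `*` (profile V @^-1` box C).
  apply/seteqP; split => -[w' w] /=.
    move=> hY; split; first by have := hY i; rewrite tnth_mktuple eqxx.
    move=> j; have := hY j; rewrite /C !tnth_mktuple.
    by case: ifP.
  move=> [hi hC] j; have := hC j; rewrite /C !tnth_mktuple.
  by case: eqP => [->|].
rewrite [RHS](@product_measure1E _ _ _ _ R P P); [|exact: mpre|]; last first.
  rewrite -[X in measurable X]setTI; apply: measurable_profile => //.
  exact: measurable_box.
have e2 := profile_boxE C mC.
transitivity (P (V i @^-1` B i) * \prod_(j < n) P (V j @^-1` C j))%E; last first.
  by rewrite -e2.
etransitivity; first exact: (profile_boxE B mB).
rewrite (bigD1 i)//= [in RHS](bigD1 i)//=.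
rewrite [in RHS]/C eqxx preimage_setT probability_setT mul1e.
by congr (_ * _)%E; apply: eq_bigr => j /negPf ji; rewrite /C ji.
Qed.

End resampling.

(** * The WPB bid for a nonnegative nondecreasing interim allocation [G] *)

Section bid.
Context {R : realType} (G : R -> R).
Hypotheses (G0 : forall x, 0 <= G x) (Gmono : {homo G : x y / x <= y}).

Let mG (D : set R) : measurable D -> measurable_fun D (EFin \o G).
Proof.
by move=> mD; apply/measurable_EFinP; apply: nondecreasing_measurable.
Qed.

Lemma integral_nondecreasing_le (D : set R) (a b M : R) : a <= b ->
  measurable D -> D `<=` `[a, b] -> (forall u, D u -> G u <= M) -> 0 <= M ->
  (\int[lebesgue_measure]_(u in D) (G u)%:E <= ((b - a) * M)%:E)%E.
Proof.
move=> ab mD Dab GM M0.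
apply: (@le_trans _ _ (\int[lebesgue_measure]_(u in D) (cst M%:E) u)%E).
  apply: ge0_le_integral => //.
  - by move=> u _; rewrite lee_fin.
  - exact: mG.
rewrite integral_cst// mulrC EFinM lee_wpmul2l ?lee_fin//.
apply: (@le_trans _ _ (@lebesgue_measure R `[a, b]%classic)).
  by apply: le_measure; rewrite ?inE//; exact: measurable_itv.
rewrite /= lebesgue_measure_itv/= lte_fin.
by case: ifP => _; rewrite ?EFinB// lee_fin subr_ge0.
Qed.

Definition interim_pay_of (x : R) : R :=
  fine ((x * G x)%:E - \int[lebesgue_measure]_(u in `[0%R, x]%classic) (G u)%:E)%E.

Definition bid_of (x : R) : R :=
  if 0 < G x then interim_pay_of x / G x else 0.

Let I x := fine (\int[lebesgue_measure]_(u in `[0%R, x]%classic) (G u)%:E).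

Let Iint_ge0 x : (0 <= \int[lebesgue_measure]_(u in `[0%R, x]%classic) (G u)%:E)%E.
Proof. by apply: integral_ge0 => u _; rewrite lee_fin. Qed.

Let Iint_le x : 0 <= x ->
  (\int[lebesgue_measure]_(u in `[0%R, x]%classic) (G u)%:E <= (x * G x)%:E)%E.
Proof.
move=> x0; rewrite -[X in (X * _)%:E]subr0; apply: integral_nondecreasing_le => //.
by move=> u /=; rewrite in_itv/= => /andP[_ ux]; exact: Gmono.
Qed.

Let I_fin x : 0 <= x ->
  (\int[lebesgue_measure]_(u in `[0%R, x]%classic) (G u)%:E = (I x)%:E)%E.
Proof.
move=> x0; rewrite fineK// ge0_fin_numE//.
exact: le_lt_trans (Iint_le x x0) (ltry _).
Qed.

Let I_ge0 x : 0 <= I x.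
Proof. by rewrite fine_ge0. Qed.

Let I_le x : 0 <= x -> I x <= x * G x.
Proof. by move=> x0; rewrite -lee_fin -I_fin// Iint_le. Qed.

Let I_add x y : 0 <= x -> x <= y -> I y <= I x + (y - x) * G y.
Proof.
move=> x0 xy; rewrite -lee_fin EFinD -!I_fin//; last exact: le_trans xy.
have -> : `[0%R, y]%classic = `[0%R, x]%classic `|` `]x, y]%classic.
  apply/seteqP; split => u /=; rewrite !in_itv/=.
    by move=> /andP[u0 uy]; case: (leP u x) => ux; [left|right]; rewrite ?u0 ?ux.
  by case=> /andP[h1 h2]; apply/andP; split => //; lra.
rewrite ge0_integral_setU//=; first last.
- rewrite disj_set2E; apply/eqP/seteqP; split => // u /=; rewrite !in_itv/=.
  by move=> [/andP[_ ux] /andP[xu _]]; lra.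
- by move=> u _; rewrite lee_fin.
- by apply: mG; apply: measurableU; exact: measurable_itv.
rewrite leeD2l//; apply: integral_nondecreasing_le => //.
- by move=> u /=; rewrite !in_itv/= => /andP[/ltW -> ->].
- by move=> u /=; rewrite in_itv/= => /andP[_ uy]; exact: Gmono.
Qed.

Let payE x : 0 <= x -> interim_pay_of x = x * G x - I x.
Proof. by move=> x0; rewrite /interim_pay_of I_fin. Qed.

Lemma interim_pay_of_EFin x : 0 <= x -> ((interim_pay_of x)%:E =
  (x * G x)%:E - \int[lebesgue_measure]_(u in `[0%R, x]%classic) (G u)%:E)%E.
Proof. by move=> x0; rewrite payE// I_fin// EFinB. Qed.

Lemma interim_pay_of_ge0 x : 0 <= x -> 0 <= interim_pay_of x.
Proof. by move=> x0; rewrite payE// subr_ge0 I_le. Qed.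

Lemma bid_of_mul x : 0 <= x -> bid_of x * G x = interim_pay_of x.
Proof.
move=> x0; rewrite /bid_of; case: ifPn => [Gx|].
  by rewrite divfK// gt_eqF.
(* The default bid 0 is consistent: if [G x = 0], then [0 <= I x <= x * G x] forces the interim
   payment to vanish as well. *)
rewrite -leNgt => Gx; have {Gx}Gx : G x = 0 by apply/le_anti; rewrite Gx G0.
have := I_le x x0; have := I_ge0 x.
by rewrite payE// Gx !mulr0 => h1 h2; lra.
Qed.

Lemma bid_of_ge0 x : 0 <= x -> 0 <= bid_of x.
Proof.
move=> x0; rewrite /bid_of; case: ifP => // _.
by rewrite divr_ge0// interim_pay_of_ge0.
Qed.

Lemma bid_of_le x : 0 <= x -> bid_of x <= x.
Proof.
move=> x0; rewrite /bid_of; case: ifP => // Gx.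
by rewrite ler_pdivrMr// payE// gerBl.
Qed.

(* Where [G > 0] the bid is [x - I x / G x], and on [[x, y]] the integral of [G]
   grows by at most [(y - x) * G y]. *)
Lemma bid_of_mono x y : 0 <= x -> x <= y -> bid_of x <= bid_of y.
Proof.
move=> x0 xy; have y0 : 0 <= y by exact: le_trans xy.
rewrite {1}/bid_of; case: ifPn => [Gx|_]; last exact: bid_of_ge0.
have Gxy : G x <= G y by exact: Gmono.
have Gy : 0 < G y by exact: lt_le_trans Gxy.
rewrite /bid_of Gy !payE//.
have h := I_add _ _ x0 xy; have Ix := I_ge0 x.
have hh : I x / G y <= I x / G x by rewrite ler_wpM2l// lef_pV2.
rewrite [leLHS](_ : _ = x - I x / G x); last by field; rewrite gt_eqF.
rewrite ler_pdivlMr//.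
apply: (@le_trans _ _ ((x - I x / G y) * G y)).
  by rewrite ler_wpM2r ?(ltW Gy)// lerB.
by rewrite mulrBl divfK ?gt_eqF//; lra.
Qed.

End bid.

(** * Independent values with a common density: null sets and interim expectations *)

Section iid_values.
Context {R : realType} {d : measure_display} {Omega : measurableType d}.
Context (P : probability Omega R) {n : nat} (vbar : R) (f : R -> R).
Variables (V : 'I_n -> Omega -> R) (i0 : 'I_n).
Hypothesis mf : measurable_fun setT f.
Hypothesis mV : forall j, measurable_fun setT (V j).
Hypothesis lawV : forall j (B : set R), measurable B ->
  P (V j @^-1` B) =
  (\int[lebesgue_measure]_(u in B `&` `[0%R, vbar]%classic) (f u)%:E)%E.
Hypothesis indV : mutually_independent P V.

Let mpre j (D : set R) : measurable D -> measurable (V j @^-1` D).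
Proof. by move=> mD; rewrite -[X in measurable X]setTI; exact: mV. Qed.

Lemma null_not_box (B : 'I_n -> set R) : (forall j, measurable (B j)) ->
  (forall j, P (V j @^-1` B j) = 1%E) ->
  measurable (~` (profile V @^-1` box B)) /\
  P (~` (profile V @^-1` box B)) = 0%E.
Proof.
move=> mB PB.
have mbox : measurable (profile V @^-1` box B).
  rewrite -[X in measurable X]setTI.
  exact: (measurable_profile V mV _ _ (measurable_box B mB)).
split; first exact: measurableC.
rewrite probability_setC//.
have -> : P (profile V @^-1` box B) = 1%E.
  by etransitivity; [exact: (profile_boxE P V indV B mB)|rewrite big1].
by rewrite subee.
Qed.

(** A law with a density does not charge points. This makes ties with a fixed value [x] negligible,
    whatever the tie-breaking. *)
Lemma value_atomless j x : P (V j @^-1` [set x]) = 0%E.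
Proof.
rewrite lawV//; apply: null_set_integral.
- by apply: measurableI => //; exact: measurable_itv.
- by apply/measurable_EFinP; apply: measurable_funTS.
- apply/eqP; rewrite eq_le measure_ge0 andbT.
  rewrite -(@lebesgue_measure_set1 R x); apply: le_measure; rewrite ?inE//.
  by apply: measurableI => //; exact: measurable_itv.
Qed.

Lemma value_in_support j : P (V j @^-1` `[0, vbar]%classic) = 1%E.
Proof.
rewrite lawV; last exact: measurable_itv.
(* The law integrates [f] over [B] cut to [[0, vbar]], so this interval has the same mass as the
   whole line. *)
rewrite setIid -(setTI `[0, vbar]%classic) -(lawV j)//.
by rewrite preimage_setT probability_setT.
Qed.

Lemma value_in_support_atomless j x :
  P (V j @^-1` (`[0, vbar]%classic `\ x)) = 1%E.
Proof.
have ms : measurable (V j @^-1` `[0, vbar]%classic) by apply: mpre; exact: measurable_itv.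
have -> : V j @^-1` (`[0, vbar]%classic `\ x) =
    V j @^-1` `[0, vbar]%classic `\` V j @^-1` [set x] by [].
rewrite measureD//; [|exact: mpre|by rewrite -ge0_fin_numE// fin_num_measure].
rewrite -[RHS]sube0; congr (_ - _)%E; first exact: value_in_support.
apply/eqP; rewrite eq_le measure_ge0 andbT -(value_atomless j x).
by apply: le_measure; rewrite ?inE; [apply: measurableI => //; exact: mpre|exact: mpre|by move=> ? []].
Qed.

(** The common distribution function, read off from the arbitrary bidder [i0]. *)
Definition cdf_value (x : R) : R := fine (P (V i0 @^-1` `]-oo, x]%classic)).

Lemma cdf_valueE j x : P (V j @^-1` `]-oo, x]%classic) = (cdf_value x)%:E.
Proof.
rewrite /cdf_value fineK; last by rewrite fin_num_measure//; by apply: mpre; exact: measurable_itv.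
by rewrite lawV ?[RHS]lawV//; exact: measurable_itv.
Qed.

Lemma cdf_value_ge0 x : 0 <= cdf_value x.
Proof. by rewrite fine_ge0. Qed.

Lemma cdf_value_mono : {homo cdf_value : x y / x <= y}.
Proof.
move=> x y xy; rewrite -lee_fin -!(cdf_valueE i0).
apply: le_measure; rewrite ?inE; try (by apply: mpre; exact: measurable_itv).
by move=> w /=; rewrite !in_itv/= => /le_trans; exact.
Qed.

(** [A] and [Pay] are constrained only on the type space; its complement is the null set off which
    integrands are compared. *)
Lemma off_null_typespace (N := ~` (profile V @^-1` @typespace R n vbar)) :
  measurable N /\ P N = 0%E.
Proof.
apply: (null_not_box (fun=> `[0, vbar]%classic)) => j; first exact: measurable_itv.
exact: value_in_support.
Qed.

Lemma typespace_upd (v : n.-tuple R) i x :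
  typespace vbar v -> x \in `[0, vbar] -> typespace vbar (upd v i x).
Proof. by move=> hv hx j; rewrite tnth_mktuple; case: ifP. Qed.

Lemma measurable_typespace : measurable (@typespace R n vbar).
Proof. by apply: (measurable_box (fun=> `[0, vbar]%classic)) => j; exact: measurable_itv. Qed.

(** This is the tower property: conditioning on bidder [i]'s value replaces [q] by its interim
    expectation [Q]. Resampling coordinate [i] fixes the weight [psi] in the inner integral, from
    which it is pulled out. *)
Lemma integral_interim (q : n.-tuple R -> R) (Q psi : R -> R) (i : 'I_n) :
  measurable_fun (@typespace R n vbar) q ->
  (forall v, typespace vbar v -> 0 <= q v) ->
  measurable_fun setT psi -> (forall x, 0 <= psi x) ->
  (forall x, x \in `[0, vbar] -> interim P V q i x = (Q x)%:E) ->
  (\int[P]_w (psi (V i w) * q (profile V w))%:E =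
   \int[P]_w (psi (V i w) * Q (V i w))%:E)%E.
Proof.
move=> mq q0 mpsi psi0 hQ.
have [mN N0] := off_null_typespace.
set N := ~` _ in mN N0.
(* Extension by zero makes [q] measurable and nonnegative everywhere, as Tonelli requires. *)
pose q' := q \_ (@typespace R n vbar).
have q'E v : typespace vbar v -> q' v = q v by move=> hv; rewrite /q' patchE mem_set.
have q'0 v : 0 <= q' v.
  by rewrite /q' patchE; case: ifPn => // hv; apply: q0; rewrite inE in hv.
have mq' : measurable_fun setT q' by apply/(measurable_restrictT _ measurable_typespace).
pose h v := (psi (tnth v i) * q' v)%:E.
transitivity (\int[P]_w h (profile V w))%E.
  apply: (eq_integral_off_null _ N) => // w /contrapT hw.
  by rewrite /h q'E// tnth_mktuple.
rewrite (ge0_integral_resample P V mV indV i h)//; last 2 first.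
- apply/measurable_EFinP; apply: measurable_funM => //.
  by apply: measurableT_comp => //; exact: measurable_tnth.
- by move=> v; rewrite lee_fin mulr_ge0.
apply: (eq_integral_off_null _ N) => // w /contrapT hw.
have hx : V i w \in `[0, vbar] by have := hw i; rewrite tnth_mktuple.
set x := V i w in hx *.
rewrite EFinM -(hQ _ hx) /interim.
transitivity (\int[P]_w0 ((psi x)%:E * (q' (upd (profile V w0) i x))%:E))%E.
  by apply: eq_integral => w' _; rewrite /h EFinM tnth_mktuple eqxx.
rewrite ge0_integralZl_EFin//; last 2 first.
- by move=> w' _; rewrite lee_fin.
- by apply/measurable_EFinP; apply: measurableT_comp => //; exact: measurable_upd_profile.
congr (_ * _)%E; apply: (eq_integral_off_null _ N) => // w' /contrapT hw'.
by rewrite q'E//; exact: typespace_upd.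
Qed.

(** * Interim allocation of the efficient rule *)

Section efficient.
Variable A : n.-tuple R -> 'I_n -> bool.
Hypothesis A1 : forall v, @typespace R n vbar v -> \sum_(i < n) ((A v i)%:R : R) = 1.
Hypothesis Amax : forall v i, @typespace R n vbar v -> A v i ->
  forall j, tnth v j <= tnth v i.

Lemma winner v : typespace vbar v -> exists2 i, A v i & forall j, j != i -> A v j = false.
Proof.
move=> hv; have sumA := A1 _ hv.
have [[i Ai]|noA] := pselect (exists i, A v i); last first.
  move: sumA; rewrite big1 => [/esym/eqP|i _]; first by rewrite oner_eq0.
  by case: (boolP (A v i)) => // Ai; exfalso; apply: noA; exists i.
exists i => // j ji; apply/negP => Aj.
move: sumA; rewrite (bigD1 i)//= (bigD1 j)//= Ai Aj => sumA.
have : 0 <= \sum_(k < n | (k != i) && (k != j)) ((A v k)%:R : R) by apply: sumr_ge0.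
by move: sumA; rewrite /=; lra.
Qed.

(** Off ties, bidder [i] with value [x] wins exactly when the [n.-1] rivals all have values at most
    [x]; independence turns this into a power of the distribution function. *)
Lemma interim_allocE i x : x \in `[0, vbar] ->
  interim P V (fun v => (A v i)%:R) i x = (cdf_value x ^+ n.-1)%:E.
Proof.
move=> hx; rewrite /interim.
(* [B] excludes values outside the support and ties with [x]; [C] is the event that all rivals are
   at most [x]. *)
pose B (j : 'I_n) := `[0, vbar]%classic `\ x.
pose C (j : 'I_n) := if j == i then setT else `]-oo, x]%classic.
have mC j : measurable (C j) by rewrite /C; case: ifP => // _; exact: measurable_itv.
have [mN N0] : measurable (~` (profile V @^-1` box B)) /\ P (~` (profile V @^-1` box B)) = 0%E.
  apply: null_not_box => j; last exact: value_in_support_atomless.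
  by apply: measurableD => //; exact: measurable_itv.
transitivity (\int[P]_w (\1_(profile V @^-1` box C) w)%:E)%E.
  apply: (eq_integral_off_null _ _ _ _ mN N0) => w /contrapT hw.
  have hB j : V j w \in `[0, vbar] /\ V j w <> x.
    by have := hw j; rewrite tnth_mktuple.
  have hu : typespace vbar (upd (profile V w) i x).
    by apply: typespace_upd => // j; rewrite tnth_mktuple; exact: (hB j).1.
  rewrite indicE; congr ((_ : bool)%:R)%:E; apply/idP/idP.
    move=> Ai; rewrite inE => j; rewrite /= /C tnth_mktuple; case: ifPn => // ji.
    have := Amax _ _ hu Ai j.
    by rewrite !tnth_mktuple eqxx (negPf ji) /= in_itv.
  rewrite inE => hC; have [k Ak _] := winner _ hu.
  have [ki|ki] := eqVneq k i; first by rewrite ki in Ak.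
  have := Amax _ _ hu Ak i; rewrite !tnth_mktuple eqxx (negPf ki) => xk.
  have := hC k; rewrite /C (negPf ki) tnth_mktuple /= in_itv/= => kx.
  (* A winner [k] other than [i] would have value exactly [x], a tie excluded by [B]. *)
  by exfalso; apply: (hB k).2; apply/le_anti; rewrite kx xk.
rewrite integral_indic//; last first.
  rewrite -[X in measurable X]setTI.
  exact: (measurable_profile V mV _ _ (measurable_box C mC)).
rewrite setIT; etransitivity; first exact: (profile_boxE P V indV C mC).
rewrite (bigD1 i)//= {1}/C eqxx preimage_setT probability_setT mul1e.
rewrite (eq_bigr (fun=> (cdf_value x)%:E)) => [|j /negPf ji]; last first.
  by rewrite /C ji cdf_valueE.
rewrite prodEFin big_const.
have -> : #|[pred j | j != i]| = n.-1.
  transitivity #|predC1 i|; first by apply: eq_card => j; rewrite !inE.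
  by rewrite cardC1 card_ord.
by rewrite -Monoid.iteropE.
Qed.

End efficient.

End iid_values.

(** * Mean-zero differences under a bounded signed weight *)

Section weighted_difference.
Context {d : measure_display} {T : measurableType d} {R : realType}.
Variable P : probability T R.

Lemma bounded_integrable (X : T -> R) (K : R) : measurable_fun setT X ->
  (forall w, `|X w| <= K) -> P.-integrable setT (EFin \o X).
Proof.
move=> mX XK; apply: (@le_integrable _ _ _ P _ measurableT _ (EFin \o cst K)).
- exact/measurable_EFinP.
- by move=> w _ /=; rewrite lee_fin (le_trans (XK w))// ler_norm.
- exact: finite_measure_integrable_cst.
Qed.

(** The tower property covers nonnegative weights only, so [psi] is shifted by its bound [M]:
    [psi * (X - Y)] equals [(psi + M) * X - (psi + M) * Y - M * (X - Y)]. [X] is integrable because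
    it has the same mean as the bounded [Y]. *)
Lemma integral_weighted_diff (X Y psi : T -> R) (K M : R) :
  measurable_fun setT X -> measurable_fun setT Y -> measurable_fun setT psi ->
  (forall w, 0 <= X w) -> (forall w, 0 <= Y w <= K) ->
  (forall w, `|psi w| <= M) ->
  (\int[P]_w (X w)%:E = \int[P]_w (Y w)%:E)%E ->
  (\int[P]_w ((psi w + M) * X w)%:E = \int[P]_w ((psi w + M) * Y w)%:E)%E ->
  P.-integrable setT (fun w => (psi w * (X w - Y w))%:E) /\
  (\int[P]_w (psi w * (X w - Y w))%:E = 0)%E.
Proof.
move=> mX mY mpsi X0 YK psiM XY pXY.
have iY : P.-integrable setT (EFin \o Y).
  apply: (bounded_integrable _ K) => // w.
  by have /andP[Y0 YK'] := YK w; rewrite ger0_norm.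
have iX : P.-integrable setT (EFin \o X).
  apply/integrableP; split; first exact/measurable_EFinP.
  under eq_integral do rewrite /= ger0_norm//.
  rewrite XY; have /integrableP[_] := iY.
  by under eq_integral => w _ do rewrite /= ger0_norm ?(andP (YK w)).1//.
have iW (Z : T -> R) : measurable_fun setT Z -> P.-integrable setT (EFin \o Z) ->
    P.-integrable setT (EFin \o (fun w => (psi w + M) * Z w)).
  move=> mZ iZ.
  apply: (@le_integrable _ _ _ P _ measurableT _ (fun w => (M + M)%:E * (EFin \o Z) w)%E).
  - apply/measurable_EFinP; apply: measurable_funM => //.
    by apply: measurable_funD.
  - move=> w _ /=; rewrite lee_fin !normrM ler_wpM2r//.
    have M0 : 0 <= M by exact: le_trans (normr_ge0 _) (psiM w).
    by rewrite (le_trans (ler_normD _ _))// [leRHS]ger0_norm ?addr_ge0// lerD// ger0_norm.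
  - exact: integrableZl.
have i1 := iW _ mX iX; have i2 := iW _ mY iY.
have i12 := integrableB measurableT i1 i2.
have i34 := integrableZl measurableT M (integrableB measurableT iX iY).
have -> : (fun w => (psi w * (X w - Y w))%:E) =
  (((EFin \o (fun w => (psi w + M) * X w)%R) \- (EFin \o (fun w => (psi w + M) * Y w)%R)) \-
   (fun w => M%:E * ((EFin \o X) \- (EFin \o Y)) w))%E.
  by apply/funext => w /=; rewrite -!EFinB; congr (_%:E); ring.
split; first exact: integrableB.
rewrite integralB// integralB// integralZl//; last exact: integrableB.
rewrite integralB// [in X in (X - _)%E]pXY [in X in (_ - X)%E]XY.
rewrite !subee ?mule0 ?sube0//; apply: integrable_fin_num => //.
Qed.

End weighted_difference.

(* The winner has the highest value, so replacing its subgradient [s (B (x k))] by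
   bidder [i]'s own [s (B (x i))] can only decrease the nonnegative terms [pay i]. *)
Lemma subgradient_revenue (R : realFieldType) (n : nat) (g s B : R -> R)
    (x pay : 'I_n -> R) (al : 'I_n -> bool) (k : 'I_n) :
  (forall y z, g y + s y * (z - y) <= g z) ->
  {homo (fun u => s (B u)) : u v / u <= v} ->
  al k -> (forall j, j != k -> al j = false) -> (forall j, x j <= x k) ->
  (forall j, 0 <= pay j) ->
  g (\sum_(i < n) B (x i) * (al i)%:R)
    + \sum_(i < n) s (B (x i)) * (pay i - B (x i) * (al i)%:R)
  <= g (\sum_(i < n) pay i).
Proof.
move=> hs phi_mono alk aln xk pay0.
have sumE (h : 'I_n -> R) : \sum_(i < n) h i * (al i)%:R = h k.
  rewrite (bigD1 k)//= alk mulr1 big1 ?addr0// => j jk.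
  by rewrite (aln _ jk) mulr0.
rewrite (sumE (fun i => B (x i))).
apply: le_trans (hs (B (x k)) _); rewrite lerD2l.
have -> : \sum_(i < n) s (B (x i)) * (pay i - B (x i) * (al i)%:R) =
    \sum_(i < n) s (B (x i)) * pay i - s (B (x k)) * B (x k).
  rewrite -(sumE (fun i => s (B (x i)) * B (x i))) -sumrB.
  by apply: eq_bigr => i _; rewrite mulrBr mulrA.
rewrite mulrBr lerB// mulr_sumr; apply: ler_sum => i _.
by rewrite ler_wpM2r//; exact: phi_mono.
Qed.

(** * The revenue comparison *)

Theorem mainTheorem7 (R : realType) (d : measure_display) (Omega : measurableType d)
    (P : probability Omega R) (n : nat) (vbar : R) (f : R -> R)
    (V : 'I_n -> Omega -> R) (A : n.-tuple R -> 'I_n -> bool) :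
  (1 < n)%N ->
  0 < vbar ->
  (* i.i.d. values with common distribution F having density f > 0 on [0, vbar] *)
  measurable_fun setT f ->
  (forall u, u \in `[0, vbar] -> 0 < f u) ->
  (forall j, measurable_fun setT (V j)) ->
  (forall j (B : set R), measurable B ->
     P (V j @^-1` B) = (\int[lebesgue_measure]_(u in B `&` `[0%R, vbar]%classic) (f u)%:E)%E) ->
  mutually_independent P V ->
  (* A is a measurable efficient allocation rule for one item (some fixed tie-breaking) *)
  (forall i, measurable_fun (@typespace R n vbar) (fun v => (A v i)%:R : R)) ->
  (forall v, @typespace R n vbar v -> \sum_(i < n) ((A v i)%:R : R) = 1) ->
  (forall v i, @typespace R n vbar v -> A v i -> forall j, tnth v j <= tnth v i) ->
  forall Pay : n.-tuple R -> 'I_n -> R,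
    (forall i, measurable_fun (@typespace R n vbar) (fun v => Pay v i)) ->
    (forall v i, @typespace R n vbar v -> 0 <= Pay v i) ->
    implements P vbar V A Pay ->
    forall g : R -> R, convex_fun g ->
      expectation_exists P (fun w => g (\sum_(i < n) pay_WPB P V A (profile V w) i)) ->
      expectation_exists P (fun w => g (\sum_(i < n) Pay (profile V w) i)) ->
      (\int[P]_w (g (\sum_(i < n) pay_WPB P V A (profile V w) i))%:E
        <= \int[P]_w (g (\sum_(i < n) Pay (profile V w) i))%:E)%E.
Proof.
move=> n1 vbar0 mf f0 mV lawV indV mA A1 Amax Pay mPay Pay0 [_ revEq] g cg _ _.
pose i0 := Ordinal (ltnW n1).
pose G x := cdf_value P V i0 x ^+ n.-1.
have G0 x : 0 <= G x by rewrite exprn_ge0//; exact: cdf_value_ge0.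
have Gmono : {homo G : x y / x <= y}.
  move=> x y xy; apply: lerXn2r; rewrite ?nnegrE; try exact: cdf_value_ge0.
  exact: (cdf_value_mono P vbar f).
have allocE i x : x \in `[0, vbar] -> interim_alloc P V A i x = G x.
  by move=> hx; rewrite /interim_alloc (interim_allocE P vbar f V i0).
have payE i x : x \in `[0, vbar] -> interim_pay P V A i x = (interim_pay_of G x)%:E.
  move=> hx; have /andP[x0 xv] : 0 <= x <= vbar by rewrite in_itv/= in hx.
  rewrite (interim_pay_of_EFin G)// /interim_pay allocE//; congr (_ - _)%E.
  apply: eq_integral => u; rewrite inE/= in_itv/= => /andP[u0 ux].
  by rewrite allocE// in_itv/= u0 (le_trans ux).
have bidE i x : x \in `[0, vbar] -> bid_WPB P V A i x = bid_of G x.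
  by move=> hx; rewrite /bid_WPB allocE// payE.
(* Clamping to [[0, vbar]] makes the bid function [B] monotone and bounded on the whole line, hence
   measurable, without changing it on the support. *)
pose clamp x : R := Num.max 0 (Num.min x vbar).
have clamp_ge0 x : 0 <= clamp x by rewrite /clamp le_max lexx.
have clamp_le x : clamp x <= vbar by rewrite /clamp ge_max (ltW vbar0) ge_min lexx orbT.
have clampE x : x \in `[0, vbar] -> clamp x = x.
  by rewrite in_itv/= => /andP[x0 xv]; rewrite /clamp min_l// max_r.
have clamp_mono : {homo clamp : x y / x <= y}.
  by move=> x y xy; rewrite /clamp; apply: le_max2 => //; exact: le_min2.
pose B x := bid_of G (clamp x).
have B0 x : 0 <= B x by exact: bid_of_ge0.
have Bv x : B x <= vbar by apply: le_trans (clamp_le x); exact: bid_of_le.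
have Bmono : {homo B : x y / x <= y}.
  by move=> x y xy; apply: bid_of_mono => //; exact: clamp_mono.
have mB : measurable_fun setT B by exact: nondecreasing_measurable.
have [s [hs smono]] := convex_monotone_subgradient g cg.
pose phi x := s (B x).
have phi_mono : {homo phi : x y / x <= y} by move=> x y xy; exact/smono/Bmono.
have mphi : measurable_fun setT phi by exact: nondecreasing_measurable.
(* On [[0, vbar]] the nondecreasing [s] lies between [s 0] and [s vbar], so [M] bounds its absolute
   value. *)
pose M := `|s 0| + `|s vbar|.
have sM y : 0 <= y -> y <= vbar -> `|s y| <= M.
  move=> y0 yv; have h1 := smono _ _ y0; have h2 := smono _ _ yv.
  have h3 := ler_norm (s vbar); have h4 := ler_norm (- s 0); rewrite normrN in h4.
  by rewrite ler_norml; apply/andP; split; rewrite /M; have := normr_ge0 (s vbar); have := normr_ge0 (s 0); lra.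
have phiM x : `|phi x| <= M by exact: sM.
have mS := @measurable_typespace R n vbar.
have [mN N0] := off_null_typespace P vbar f V mV lawV indV.
set N := ~` _ in mN N0.
have S_in w i : typespace vbar (profile V w) -> V i w \in `[0, vbar].
  by move=> /(_ i); rewrite tnth_mktuple.
(* [X] and [a] are the payments and allocations extended by zero off the type space, hence
   measurable in [w]. *)
pose X i w := ((fun v => Pay v i) \_ (@typespace R n vbar)) (profile V w).
pose a i w := ((fun v => (A v i)%:R : R) \_ (@typespace R n vbar)) (profile V w).
have mprof := measurable_profile V mV.
have mX i : measurable_fun setT (X i).
  by apply: measurableT_comp => //; exact/(measurable_restrictT _ mS).
have ma i : measurable_fun setT (a i).
  by apply: measurableT_comp => //; exact/(measurable_restrictT _ mS).
have XE i w : ~ N w -> X i w = Pay (profile V w) i.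
  by move=> /contrapT hw; rewrite /X patchE mem_set.
have aE i w : ~ N w -> a i w = (A (profile V w) i)%:R.
  by move=> /contrapT hw; rewrite /a patchE mem_set.
have X0 i w : 0 <= X i w.
  by rewrite /X patchE; case: ifPn => // hv; apply: Pay0; rewrite inE in hv.
have a01 i w : 0 <= a i w <= 1.
  by rewrite /a patchE; case: ifPn => _; rewrite ?lexx ?ler01 ?ler0n ?lern1 ?leq_b1.
pose Y i w := B (V i w) * a i w.
have mY i : measurable_fun setT (Y i).
  by apply: measurable_funM => //; exact: measurableT_comp.
have Y0v i w : 0 <= Y i w <= vbar.
  have /andP[a0 a1] := a01 i w.
  by rewrite /Y mulr_ge0//= -[leRHS]mulr1 ler_pM.
(* By revenue equivalence both sides equal E[psi(V_i) z_i(V_i)]. *)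
have balance (psi : R -> R) i : measurable_fun setT psi -> (forall x, 0 <= psi x) ->
    (\int[P]_w (psi (V i w) * X i w)%:E = \int[P]_w (psi (V i w) * Y i w)%:E)%E.
  move=> mpsi psi0.
  transitivity (\int[P]_w (psi (V i w) * interim_pay_of G (V i w))%:E)%E.
    rewrite -(integral_interim P vbar f V mV lawV indV (fun v => Pay v i) _ psi i)//.
    - by apply: (eq_integral_off_null _ N) => // w hw; rewrite XE.
    - by move=> v; exact: Pay0.
    - by move=> x hx; rewrite revEq// payE.
  (* On the type space the interim payment is [B * G]; the tower property is then applied to the
     allocation with weight [psi * B]. *)
  transitivity (\int[P]_w ((psi (V i w) * B (V i w)) * G (V i w))%:E)%E.
    apply: (eq_integral_off_null _ N) => // w /contrapT hw.
    have hV := S_in _ i hw; have := hV; rewrite in_itv/= => /andP[V0 _].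
    by rewrite /B clampE// -mulrA bid_of_mul.
  rewrite -(integral_interim P vbar f V mV lawV indV (fun v => (A v i)%:R) G
    (fun x => psi x * B x) i)//.
  - by apply: (eq_integral_off_null _ N) => // w hw; rewrite /Y aE// mulrA.
  - exact: measurable_funM.
  - by move=> x; rewrite mulr_ge0.
  - by move=> x hx; rewrite (interim_allocE P vbar f V i0).
(* The correction term of bidder [i], weighted by the subgradient at that bidder's own bid. *)
pose D i w := (phi (V i w) * (X i w - Y i w))%:E.
have D0 i : P.-integrable setT (D i) /\ (\int[P]_w D i w = 0)%E.
  apply: (integral_weighted_diff P (X i) (Y i) (phi \o V i) vbar M) => //.
  - exact: measurableT_comp.
  - by move=> w; exact: phiM.
  - have mul1 Z : (\int[P]_w (Z w)%:E = \int[P]_w (1 * Z w)%:E)%E.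
      by apply: eq_integral => w _; rewrite mul1r.
    by rewrite (mul1 (X i)) (mul1 (Y i)); apply: (balance (fun=> 1)).
  (* The weight [phi + M] is nonnegative because [M] bounds the absolute value of [phi]. *)
  - apply: (balance (fun x => phi x + M)) => [|x]; first exact: measurable_funD.
    by have := phiM x; rewrite ler_norml => /andP[h _]; lra.
pose W w := \sum_(i < n) Y i w.
have mW : measurable_fun setT W by exact: measurable_sum.
have W0v w : 0 <= W w <= vbar.
  rewrite /W; have [Nw|hw] := pselect (N w).
    rewrite big1 ?lexx ?(ltW vbar0)// => i _.
    by rewrite /Y /a patchE memNset ?mulr0.
  have /contrapT hS := hw; have [k Ak An] := winner _ _ A1 _ hS.
  rewrite (bigD1 k)//= big1 ?addr0 // => j jk.
  by rewrite /Y aE// An// mulr0.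
(* The subgradient inequalities at 0 and at [W w] bound [g (W w)] from below and above. *)
have igW : P.-integrable setT (EFin \o (g \o W)).
  apply: (bounded_integrable _ _ (`|g 0| + M * vbar)).
    by apply: measurableT_comp => //; exact: convex_measurable.
  move=> w /=; have /andP[w0 wv] := W0v w.
  have h1 := hs 0 (W w); have h2 := hs (W w) 0.
  have := sM _ w0 wv; rewrite ler_norml => /andP[h3 h4].
  have := sM _ (lexx 0) (ltW vbar0); rewrite ler_norml => /andP[h5 h6].
  have := ler_norm (g 0); have := ler_norm (- g 0); rewrite normrN => h7 h8.
  by rewrite ler_norml; apply/andP; split; nra.
have iD : P.-integrable setT (fun w => \sum_(i < n) D i w)%E.
  by apply: integrable_sum => // i _; exact: (D0 i).1.
have intD : (\int[P]_w (\sum_(i < n) D i w) = 0)%E.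
  rewrite integral_sum//; last by move=> i; exact: (D0 i).1.
  by rewrite big1// => i _; exact: (D0 i).2.
(* The corrections have total mean zero, so adding them to [g (W w)] preserves the WPB expectation;
   what remains is a pointwise inequality off [N]. *)
apply: (@le_trans _ _ (\int[P]_w ((EFin \o (g \o W)) w + \sum_(i < n) D i w))%E).
  rewrite integralD// [in X in (_ + X)%E]intD adde0.
  apply: (le_integral_off_null _ N) => // w hw /=.
  rewrite lee_fin le_eqVlt; apply/orP; left; apply/eqP; congr (g _).
  apply: eq_bigr => i _; rewrite /pay_WPB tnth_mktuple /Y aE// /B.
  by have /contrapT /(S_in _ i) hV := hw; rewrite clampE// bidE.
apply: (le_integral_off_null _ N) => // w hw /=.
rewrite /D sumEFin -EFinD lee_fin.
have /contrapT hS := hw.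
have [k Ak An] := winner _ _ A1 _ hS.
have := subgradient_revenue _ n g s B (fun i => V i w) (fun i => Pay (profile V w) i)
  (A (profile V w)) k hs phi_mono Ak An.
have -> : W w = \sum_(i < n) B (V i w) * (A (profile V w) i)%:R.
  by apply: eq_bigr => i _; rewrite /Y aE.
have -> : \sum_(i < n) phi (V i w) * (X i w - Y i w) =
    \sum_(i < n) s (B (V i w)) * (Pay (profile V w) i - B (V i w) * (A (profile V w) i)%:R).
  by apply: eq_bigr => i _; rewrite XE// /Y aE.
apply => j; last exact: Pay0.
by have := Amax _ _ hS Ak j; rewrite !tnth_mktuple.
Qed.
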